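(* Let $t \geq 2$ be an even integer and let $G$ be a $2$-connected $2t$-regular graph. Let $\mathcal{O}$ be a set of pairwise edge-disjoint odd cycles of $G$. Then there exists a $t$-factor $F$ of $G$ such that for every $O \in \mathcal{O}$ both $E(O) \cap E(F) \neq \emptyset$ and $E(O) \cap (E(G) \setminus E(F)) \neq \emptyset$.
   Context: All graphs are finite and loopless but may have parallel edges. A cycle is a connected $2$-regular subgraph (so two parallel edges form a cycle of length 2); a cycle is odd if it has an odd number of edges. A $t$-factor of $G$ is a spanning $t$-regular subgraph. $2$-connected means connected with no cut-vertex. *)

(* Defs.v *)
From mathcomp Require Import all_boot.
Set Implicit Arguments. Unset Strict Implicit. Unset Printing Implicit Defensive.

(* A finite multigraph: vertex type V, edge type E, and [ends e] the pair of
   endpoints of edge e.  Parallel edges are allowed (distinct e with equal ends).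
   Looplessness is a separate hypothesis ([loopless]). Subgraphs are given by
   edge sets {set E}. *)
Section Graphs.
Variables (V E : finType) (ends : E -> V * V).

Definition loopless : Prop := forall e, (ends e).1 != (ends e).2.

Definition incident (e : E) (v : V) : bool :=
  ((ends e).1 == v) || ((ends e).2 == v).

Definition deg_in (S : {set E}) (v : V) : nat :=
  #|[set e in S | incident e v]|.

Definition regular (k : nat) : Prop := forall v, deg_in setT v = k.

Definition adj_in (S : {set E}) : rel V :=
  fun x y => [exists e in S, ((ends e == (x, y)) || (ends e == (y, x)))].

Definition connected_graph : Prop :=
  forall x y : V, connect (adj_in setT) x y.

Definition adj_del (v : V) : rel V :=
  fun x y => [&& x != v, y != v & adj_in setT x y].

Definition two_connected : Prop :=
  connected_graph /\
  forall v x y : V, x != v -> y != v -> connect (adj_del v) x y.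

Definition is_factor (t : nat) (F : {set E}) : Prop :=
  forall v, deg_in F v = t.

Definition verts_of (C : {set E}) : pred V := fun v => [exists e in C, incident e v].

Definition is_cycle (C : {set E}) : Prop :=
  C != set0 /\
  (forall v, verts_of C v -> deg_in C v = 2) /\
  (forall x y, verts_of C x -> verts_of C y -> connect (adj_in C) x y).

Definition is_odd_cycle (C : {set E}) : Prop := is_cycle C /\ odd #|C|.

End Graphs.

(* Main.v *)
Require Import Defs.
From mathcomp Require Import all_boot.
From mathcomp Require Import all_algebra zify.
Set Implicit Arguments. Unset Strict Implicit. Unset Printing Implicit Defensive.
Import GRing.Theory.

(** Pair up the half-edges at every vertex so that an edge of a prescribed odd
    cycle is only ever paired with an edge of the same cycle.  These pairs
    (transitions) decompose G into closed trails, and every prescribed cycle is a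
    union of trails, one of which is odd.  Let B be the bipartite multigraph
    between trails and vertices of G whose edges are the transitions; since G is
    2-connected, B has no bridge.

    It suffices to find a set J of transitions such that each trail has an even
    number of transitions outside J, each odd trail has at least one, and J comes
    with a pairing M of transitions at the same vertex.  Indeed, if J is minimal
    with these properties then there is a 2-colouring of the edges alternating at
    every transition outside J, constant at every transition in J, and with
    opposite colours on M-partners: the obstruction to solving this linear system
    over F_2 would be a subset of J with even intersection with every trail, which
    could be removed from J.  Each colour class is then a t-factor.

    Such a J is read off a perfect matching of the line graph of B, enlarged by
    two extra vertices for each odd trail that are joined to its transitions.
    Tutte's condition follows by discharging: a deleted transition gives 2/3 to
    the component at its trail and 1/3 to the component at its vertex, and parity
    (t is even) together with the absence of bridges ensures that every odd
    component receives at least 1. *)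

(** * Hall and Tutte *)

Lemma even_involution (T : finType) (A : {set T}) (f : T -> T) :
  {in A, forall x, [/\ f x \in A, f (f x) = x & f x != x]} -> ~~ odd #|A|.
Proof.
elim: {A}_.+1 {-2}A (ltnSn #|A|) => // n IH A; rewrite ltnS => ltA Hf.
have [-> | [x xA]] := set_0Vmem A; first by rewrite cards0.
have [fxA ffx fx] := Hf x xA.
have fxA' : f x \in A :\ x by rewrite !inE fx.
have := cardsD1 (f x) (A :\ x); rewrite fxA' /= => cA1.
have := cardsD1 x A; rewrite xA cA1 => cA.
rewrite cA /= negbK; apply: IH; first by lia.
move=> y /[!inE] => /and3P [yfx yx yA].
have [fyA ffy fy] := Hf y yA; split=> //.
rewrite fyA andbT; apply/andP; split.
  by apply: contraNneq yx => fyfx; rewrite -ffy fyfx ffx.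
by apply: contraNneq yfx => fyx; rewrite -fyx ffy.
Qed.

(** Induction on [A]. A nonempty proper subset whose neighbourhood is no larger than itself splits
    the problem in two. If there is none, any [i0] may take any neighbour [x0], since all smaller
    subsets have a neighbour to spare. Values lie in [option T] because [T] may be empty. *)
Lemma hall (I T : finType) (N : I -> {set T}) (A : {set I}) :
  (forall B : {set I}, B \subset A -> #|B| <= #|\bigcup_(i in B) N i|) ->
  exists2 f : I -> option T, {in A, forall i, exists2 x, f i = Some x & x \in N i} &
    {in A &, injective f}.
Proof.
elim: {A}_.+1 {-2}A (ltnSn #|A|) N => // n IH A; rewrite ltnS => ltA N HN.
have [-> | [i0 i0A]] := set_0Vmem A.
  by exists (fun=> None) => i; rewrite inE.
case: (boolP [exists B : {set I}, [&& B != set0, B \proper A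
    & #|\bigcup_(i in B) N i| <= #|B|]]) => [/existsP[B /and3P[B0 BA tightB]]|].
  have sBA := proper_sub BA.
  have [||f fN fI] := IH B _ N.
  - exact: leq_trans (proper_card BA) ltA.
  - by move=> C sCB; apply: HN; apply: subset_trans sCB sBA.
  have [||g gN gI] := IH (A :\: B) _ (fun i => N i :\: \bigcup_(j in B) N j).
  - apply: leq_trans ltA; rewrite cardsD (setIidPr sBA) ltn_subrL.
    by rewrite (leq_trans _ (subset_leq_card sBA)) card_gt0 B0.
  - move=> C sC.
    have dBC : [disjoint C & B].
      by move: sC; rewrite subsetD => /andP[].
    (* Hall's condition for [C :|: B], less the tight [B], is the condition for [C] once the
       neighbours of [B] are removed. *)
    have := HN (C :|: B); rewrite subUset sBA andbT.
    rewrite (subset_trans sC (subsetDl _ _)) => /(_ isT).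
    rewrite cardsU disjoint_setI0 // cards0 subn0 bigcup_setU  => H.
    have -> : \bigcup_(i in C) (N i :\: \bigcup_(j in B) N j) =
              (\bigcup_(i in C) N i) :\: \bigcup_(j in B) N j.
      apply/setP=> x; apply/bigcupP/idP => [[i iC]|]; rewrite !inE => /andP[xB H'].
        by rewrite xB; apply/bigcupP; exists i.
      by case/bigcupP: H' => i iC xi; exists i; rewrite // !inE xB.
    rewrite cardsD.
    have := subset_leq_card (subsetIl (\bigcup_(i in C) N i) (\bigcup_(j in B) N j)).
    by move: H tightB; rewrite cardsU; lia.
  exists (fun i => if i \in B then f i else g i).
    move=> i iA; case: ifP => iB; first exact: fN.
    have [|x gx] := gN i; first by rewrite inE iB.
    by rewrite inE => /andP[_ xN]; exists x.
  move=> i j iA jA /=; case: ifP => iB; case: ifP => jB.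
  - exact: fI.
  - have [x -> xN] := fN _ iB; have [|y ->] := gN j; first by rewrite inE jB.
    rewrite inE => /andP[yN _] [xy]; case/negP: yN; rewrite -xy.
    by apply/bigcupP; exists i.
  - have [x -> xN] := fN _ jB; have [|y ->] := gN i; first by rewrite inE iB.
    rewrite inE => /andP[yN _] [xy]; case/negP: yN; rewrite xy.
    by apply/bigcupP; exists j.
  - by apply: gI; rewrite inE ?iB ?jB.
rewrite negb_exists => /forallP slack.
have : 0 < #|\bigcup_(i in [set i0]) N i|.
  by apply: leq_trans (HN _ _); rewrite ?cards1 ?sub1set.
rewrite big_set1 card_gt0 => /set0Pn[x0 x0N].
have [||f fN fI] := IH (A :\ i0) _ (fun i => N i :\ x0).
- by apply: leq_trans ltA; rewrite [leqRHS](cardsD1 i0) i0A.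
- move=> C sC.
  have [->|C0] := eqVneq C set0; first by rewrite cards0.
  have pC : C \proper A.
    apply: sub_proper_trans sC _; exact: properD1.
  have := slack C; rewrite C0 pC /= -ltnNge => lt.
  have -> : \bigcup_(i in C) (N i :\ x0) = (\bigcup_(i in C) N i) :\ x0.
    apply/setP=> x; apply/bigcupP/idP => [[i iC]|]; rewrite !inE => /andP[xx0 H].
      by rewrite xx0; apply/bigcupP; exists i.
    by case/bigcupP: H => i iC xi; exists i; rewrite // !inE xx0.
  rewrite -ltnS; apply: leq_trans lt _.
  by rewrite [leqLHS](cardsD1 x0); case: (_ \in _).
exists (fun i => if i == i0 then Some x0 else f i).
  move=> i iA; case: eqP => [->|/eqP ii0]; first by exists x0.
  have [|x fx] := fN i; first by rewrite !inE ii0.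
  by rewrite inE => /andP[_ xN]; exists x.
move=> i j iA jA /=; case: eqP => [->|/eqP ii0]; case: eqP => [->|/eqP jj0] //.
- have [|x -> ] := fN j; first by rewrite !inE jj0.
  by rewrite !inE => /andP[xx _] [x0x]; rewrite x0x eqxx in xx.
- have [|x -> ] := fN i; first by rewrite !inE ii0.
  by rewrite !inE => /andP[xx _] [x0x]; rewrite x0x eqxx in xx.
- by apply: fI; rewrite !inE ?ii0 ?jj0.
Qed.

Section Tutte.
Variables (T : finType) (e : rel T).
Hypothesis e_sym : symmetric e.
Implicit Types (A U S C D : {set T}) (c : {set {set T}}).

Definition matching (A : {set T}) (M : T -> T) : Prop :=
  {in A, forall x, [/\ M x \in A, M (M x) = x & e x (M x)]}.

(* The members need not be connected: any disjoint odd sets with all their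
   A-neighbours in themselves or in U are allowed.  Tutte's condition is equivalent
   for these, and no connected component ever has to be named. *)
Definition odd_family (A U : {set T}) (c : {set {set T}}) : bool :=
  trivIset c && [forall C in c, [&& odd #|C|, C \subset A :\: U &
    [forall x in C, forall y in A, e x y ==> (y \in C :|: U)]]].

Lemma odd_familyP (A U : {set T}) (c : {set {set T}}) :
  reflect ({in c &, forall (C D : {set T}) x, x \in C -> x \in D -> C = D} /\
           {in c, forall C : {set T}, [/\ odd #|C|, C \subset A :\: U &
             forall x y, x \in C -> y \in A -> e x y -> y \in C :|: U]})
          (odd_family A U c).
Proof.
apply: (iffP andP) => [[/trivIsetP tI /forall_inP H]|[tI H]]; split.
- move=> C D Cc Dc x xC xD; apply/eqP; apply: contraTT xD => CD.
  by rewrite (disjointFr (tI _ _ Cc Dc CD)).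
- move=> C /H /and3P[-> -> /forall_inP H']; split=> // x y xC yA exy.
  by have /forall_inP/(_ y yA)/implyP/(_ exy) := H' x xC.
- apply/trivIsetP => C D Cc Dc; apply: contraNT; rewrite -setI_eq0.
  by case/set0Pn=> x /setIP[xC xD]; apply/eqP; apply: (tI C D _ _ x).
- apply/forall_inP => C /H[-> -> H']; apply/forall_inP => x xC.
  by apply/forall_inP => y yA; apply/implyP; apply: H'.
Qed.

Definition tutte_condition (A : {set T}) : Prop :=
  forall U c, U \subset A -> odd_family A U c -> #|c| <= #|U|.

Lemma matching_bigcup (I : finType) (F : I -> {set T}) (B : {set I}) :
  {in B &, forall i j x, x \in F i -> x \in F j -> i = j} ->
  {in B, forall i, exists M, matching (F i) M} ->
  exists M, matching (\bigcup_(i in B) F i) M.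
Proof.
move=> dF mF.
have /fin_all_exists[M HM] : forall i, exists M, i \in B -> matching (F i) M.
  by move=> i; case: (boolP (i \in B)) => [/mF[M HM]|_]; [exists M | exists id].
pose N x := if [pick i in B | x \in F i] is Some i then M i x else x.
have NE i x : i \in B -> x \in F i -> N x = M i x.
  move=> iB xF; rewrite /N; case: pickP => [j /andP[jB xj]|/(_ i)].
    by rewrite (dF _ _ iB jB x).
  by rewrite iB xF.
exists N => x /bigcupP[i iB xF]; have [MF MM eM] := HM i iB x xF.
rewrite (NE i) //; split=> //; first by apply/bigcupP; exists i.
by rewrite (NE i).
Qed.

Lemma card_odd_family A U c : U \subset A -> odd_family A U c ->
  odd #|A :\: U :\: cover c| = odd (#|A| + #|U| + #|c|).
Proof.
move=> UA /[dup] /andP[/eqP tI _] /odd_familyP[_ Hc].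
have sc : cover c \subset A :\: U by apply/bigcupsP => C /Hc[].
have : odd (#|cover c|) = odd #|c|.
  rewrite -tI -sum1_card; apply: (big_ind2 (fun a b => odd a = odd b)) => //.
    by move=> a b a' b'; rewrite !oddD => -> ->.
  by move=> C /Hc[->].
have := subset_leq_card UA; have := subset_leq_card sc.
have := cardsD A U; have := cardsD (A :\: U) (cover c).
by rewrite (setIidPr sc) (setIidPr UA); lia.
Qed.

(** Members have neighbours only in themselves and in [U], so by symmetry the rest has none in a
    member. Whenever parity makes the rest odd, the family therefore gains a member. *)
Lemma odd_family_rest A U c : odd_family A U c ->
  odd #|A :\: U :\: cover c| ->
  odd_family A U ((A :\: U :\: cover c) |: c) /\
  #|(A :\: U :\: cover c) |: c| = #|c|.+1.
Proof.
move=> /odd_familyP[tI Hc] oW; set W := _ :\: cover c in oW *.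
have W0 : W \notin c.
  apply: contraTN oW => Wc; suff -> : W = set0 by rewrite cards0.
  apply/eqP; apply: contraT => /set0Pn[x xW].
  have : x \in cover c by apply/bigcupP; exists W.
  by move: xW; rewrite !inE => /andP[/negbTE->].
split; last by rewrite cardsU1 W0.
have dW C x : C \in c -> x \in C -> x \notin W.
  by move=> Cc xC; rewrite !inE negb_and negbK; apply/orP; left; apply/bigcupP; exists C.
apply/odd_familyP; split.
  move=> C D /setU1P[->|Cc] /setU1P[->|Dc] x //.
  - by move=> xW xD; case/negP: (dW _ _ Dc xD).
  - by move=> xC xW; case/negP: (dW _ _ Cc xC).
  - exact: tI.
move=> C /setU1P[->|/Hc //]; split=> //; first exact: subsetDl.
move=> x y xW yA exy; rewrite !inE yA andbT.
case: (boolP (y \in U)) => [_|yU]; rewrite ?orbT // orbF andbT.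
apply/negP=> /bigcupP[D Dc yD]; have [_ _ HD] := Hc D Dc.
have xAU : x \in A :\: U by move: xW; rewrite inE => /andP[].
have [xA xU] := setDP xAU.
have := HD y x yD xA; rewrite e_sym => /(_ exy).
by rewrite inE (negbTE xU) orbF => xD; case/negP: (dW _ _ Dc xD).
Qed.

(* A tight U of maximal size covers A together with its odd sets C, each C minus a
   vertex again satisfies Tutte's condition, and Hall's theorem matches U with the
   sets C. *)
Theorem tutte A : tutte_condition A -> exists M, matching A M.
Proof.
elim: {A}_.+1 {-2}A (ltnSn #|A|) => // n IH A; rewrite ltnS => ltA TA.
have ev0 : odd_family A set0 set0.
  by apply/odd_familyP; split=> C; rewrite inE.
have evA : ~~ odd #|A|.
  apply/negP=> oA; have := odd_family_rest ev0.
  have -> : A :\: set0 :\: cover set0 = A by rewrite /cover big_set0 !setD0.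
  by case/(_ oA)=> /(TA _ _ (sub0set _)) + cE; rewrite cE !cards0.
pose tight U := (U \subset A) && [exists c, odd_family A U c && (#|c| == #|U|)].
have t0 : tight set0.
  by rewrite /tight sub0set; apply/existsP; exists set0; rewrite ev0 !cards0 /=.
case: (arg_maxnP (fun U => #|U|) t0) => U /andP[UA /existsP[c /andP[Hc /eqP cU]]] maxU.
have {}maxU U' c' : U' \subset A -> odd_family A U' c' -> #|U'| <= #|c'| -> #|U'| <= #|U|.
  move=> U'A Hc' le; apply: maxU; rewrite /tight U'A; apply/existsP; exists c'.
  by rewrite Hc' eqn_leq le TA.
have evW : ~~ odd #|A :\: U :\: cover c|.
  by rewrite card_odd_family // cU !oddD (negbTE evA); case: odd.
have /odd_familyP[tI cP] := Hc.
(* Otherwise a point [w] of the rest moves into [U]; what remains is odd and joins [c], which makes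
   a larger tight set. *)
have W0 : A :\: U :\: cover c = set0.
  apply/eqP; apply: contraNT evW => /set0Pn[w wW].
  have [/setDP[wA wU] wc] := setDP wW.
  apply/negP => evW; move: evW.
  set W := _ :\: cover c; move=> evW.
  have wUA : w |: U \subset A by rewrite subUset sub1set wA.
  have Hc' : odd_family A (w |: U) c.
    apply/odd_familyP; split=> // C Cc; have [oC sC nC] := cP C Cc; split=> //.
      apply/subsetP => x xC; have /setDP[xA xU] := subsetP sC x xC.
      rewrite !inE negb_or xU xA !andbT; apply: contraNneq wc => <-.
      by apply/bigcupP; exists C.
    move=> x y xC yA exy; have := nC x y xC yA exy.
    by rewrite !inE => /orP[->|->]; rewrite ?orbT.
  have := odd_family_rest Hc'.
  rewrite card_odd_family // cardsU1 wU cU => -[|Hc'' cE].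
    by rewrite !oddD (negbTE evA) /=; case: (odd _).
  by have := maxU _ _ wUA Hc''; rewrite cE cardsU1 wU ltnn => /(_ (leqnn _)).
have matchD C v : C \in c -> v \in C -> exists M, matching (C :\ v) M.
  move=> Cc vC; have [oC sC nC] := cP C Cc.
  have cC := cardsD1 v C; rewrite vC in cC.
  have vAU := subsetP sC v vC; have [vA vU] := setDP vAU.
  apply: IH.
    have := subset_leq_card (subset_trans sC (subsetDl _ _)).
    by rewrite cC => le; exact: leq_trans le ltA.
  (* If [q] had two members more than [S], then [v |: (U :|: S)] would be tight with [q] and the
     other members of [c], against the maximality of [U]. An excess of exactly one is excluded
     afterwards by parity, as [C :\ v] is even. *)
  have key S q : S \subset C :\ v -> odd_family (C :\ v) S q -> #|q| <= #|S|.+1.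
    move=> sS Hq; rewrite leqNgt; apply/negP => lt.
    have /odd_familyP[tq qP] := Hq.
    have qC D : D \in q -> D \subset C :\ v.
      by move=> /qP[_ + _] => /subset_trans; apply; apply: subsetDl.
    have dq D D' : D \in q -> D' \in c :\ C -> {in D, forall x, x \notin D'}.
      move=> Dq; rewrite !inE => /andP[D'C D'c] x xD; apply: contraNN D'C => xD'.
      have /setD1P[_ xC] := subsetP (qC D Dq) x xD.
      by apply/eqP; apply: (tI D' C _ _ x).
    have q0 : [disjoint q & c :\ C].
      rewrite -setI_eq0; apply/eqP/setP => D; rewrite in_set0; apply/negP => /setIP[Dq Dc].
      have [oD _ _] := qP D Dq.
      have /set0Pn[x xD] : D != set0 by apply: contraTneq oD => ->; rewrite cards0.
      by case/negP: (dq D D Dq Dc x xD).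
    have sSA : v |: (U :|: S) \subset A.
      rewrite !subUset sub1set vA UA /=; apply: subset_trans sS _.
      apply: subset_trans (subsetDl _ _) _; exact: subset_trans sC (subsetDl _ _).
    have dUS : [disjoint U & S].
      rewrite disjoint_sym; apply: disjointWl sS _; apply: disjointWl (subsetDl _ _) _.
      by apply: disjointWl sC _; rewrite -setI_eq0 setIDAC setDIl setDv setI0.
    have vUS : v \notin U :|: S.
      rewrite inE negb_or vU; apply/negP => vS.
      by have := subsetP sS v vS; rewrite !inE eqxx.
    have Hn : odd_family A (v |: (U :|: S)) (q :|: (c :\ C)).
      apply/odd_familyP; split.
        move=> D D' /setUP[Dq|Dc] /setUP[D'q|D'c] x xD xD'.
        - exact: (tq _ _ _ _ x).
        - by case/negP: (dq _ _ Dq D'c x xD).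
        - by case/negP: (dq _ _ D'q Dc x xD').
        - by move/setD1P: Dc => [_ Dc]; move/setD1P: D'c => [_ D'c]; apply: (tI _ _ _ _ x).
      move=> D /setUP[Dq|/setD1P[DC Dc]].
        have [oD sD nD] := qP D Dq; split=> //.
          apply/subsetP => x xD; have /setDP[/setD1P[xv xC] xS] := subsetP sD x xD.
          have /setDP[xA xU] := subsetP sC x xC.
          by rewrite !inE !negb_or xv xU xS.
        move=> x y xD yA exy; have /setDP[/setD1P[xv xC] xS] := subsetP sD x xD.
        have := nC x y xC yA exy; rewrite !inE => /orP[yC|->]; rewrite ?orbT //.
        have [->|yv] := eqVneq y v; rewrite ?orbT //=.
        by have := nD x y xD _ exy; rewrite !inE yv => /(_ yC)/orP[->|->]; rewrite ?orbT.
      have [oD sD nD] := cP D Dc; split=> //.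
        apply/subsetP => x xD; have /setDP[xA xU] := subsetP sD x xD.
        have xC : x \notin C by apply: contraNN DC => xC; apply/eqP/(tI D C _ _ x).
        rewrite !inE !negb_or xU xA !andbT; apply/andP; split.
          by apply: contraNneq xC => ->.
        by apply: contraNN xC => /(subsetP sS)/setD1P[].
      move=> x y xD yA exy; have := nD x y xD yA exy.
      by rewrite !inE => /orP[->|->]; rewrite ?orbT.
    have := maxU _ _ sSA Hn.
    rewrite !cardsU1 vUS cardsU disjoint_setI0 // cards0 subn0.
    rewrite cardsU disjoint_setI0 // cards0 subn0.
    move: lt cU; rewrite (cardsD1 C c) Cc.
    by rewrite add1n; move: #|c :\ C| #|q| #|S| #|U| => nc nq nS nU; clear; lia.
  move=> S q sS Hq; have := key S q sS Hq; rewrite leq_eqVlt ltnS => /orP[/eqP qS|//].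
  have := odd_family_rest Hq; rewrite card_odd_family // => -[|Hq' cE].
    by move: oC; rewrite cC qS !oddD /=; do 2!case: odd.
  by have := key _ _ sS Hq'; rewrite cE qS ltnn.
(* Hall's condition holds because the members in [B] form an odd family for their own neighbours in
   [U], so Tutte's condition bounds their number. *)
have [|f fN fI] := @hall _ _ (fun C => [set u in U | [exists v in C, e v u]]) c.
  move=> B sB; set N := \bigcup_(_ in _) _.
  have sN : N \subset U by apply/bigcupsP => C _; apply/subsetP => x; rewrite inE => /andP[].
  apply: TA (subset_trans sN UA) _.
  apply/odd_familyP; split.
    by move=> C D /(subsetP sB) Cc /(subsetP sB) Dc; apply: tI.
  move=> C CB; have [oC sC nC] := cP C (subsetP sB C CB); split=> //.
    by apply: subset_trans sC _; apply: setDS.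
  move=> x y xC yA exy; have := nC x y xC yA exy; rewrite !inE => /orP[->//|yU].
  apply/orP; right; apply/bigcupP; exists C => //; rewrite inE yU.
  by apply/existsP; exists x; rewrite xC.
have fU x : x \in U -> exists2 C, C \in c & f C = Some x.
  move=> xU; suff : Some x \in f @: c by case/imsetP => C Cc ->; exists C.
  suff -> : f @: c = Some @: U by apply: imset_f.
  apply/eqP; rewrite eqEcard (card_imset _ (@Some_inj _)) card_in_imset //.
  rewrite cU leqnn andbT; apply/subsetP => _ /imsetP[C Cc ->].
  by have [y -> ] := fN C Cc; rewrite inE => /andP[yU _]; apply: imset_f.
have -> : A = \bigcup_(C in c) (C :|: [set x | f C == Some x]).
  apply/eqP; rewrite eqEsubset; apply/andP; split.
    apply/subsetP => x xA; case: (boolP (x \in U)) => [/fU[C Cc fC]|xU].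
      by apply/bigcupP; exists C; rewrite // !inE fC eqxx orbT.
    have : x \in cover c.
      by apply: contraTT isT => xc; have := in_set0 x; rewrite -W0 !inE xc xU xA.
    by case/bigcupP => C Cc xC; apply/bigcupP; exists C; rewrite // inE xC.
  apply/bigcupsP => C Cc; rewrite subUset; apply/andP; split.
    by have [_ + _] := cP C Cc => /subset_trans; apply; apply: subsetDl.
  apply/subsetP => x; rewrite inE => /eqP fx.
  by have [y] := fN C Cc; rewrite fx inE => -[<-] /andP[/(subsetP UA)].
have CU C x : C \in c -> x \in C -> x \notin U.
  by move=> Cc xC; have [_ /subsetP/(_ x xC)/setDP[]] := cP C Cc.
apply: matching_bigcup.
  have inU C x : C \in c -> f C = Some x -> x \in U.
    by move=> Cc fC; have [y] := fN C Cc; rewrite fC inE => -[<-] /andP[].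
  move=> C D Cc Dc x; rewrite !inE => /orP[xC|/eqP fC] /orP[xD|/eqP fD].
  - exact: tI xC xD.
  - by case/negP: (CU _ _ Cc xC); apply: inU fD.
  - by case/negP: (CU _ _ Dc xD); apply: inU fC.
  - by apply: fI => //; rewrite fC fD.
move=> C Cc; have [u fu] := fN C Cc; rewrite inE => /andP[uU /exists_inP[v vC evu]].
have uC : u \notin C by apply: contraTN uU => /(CU _ _ Cc).
have vu : v != u by apply: contraNneq uC => <-.
have [M HM] := matchD C v Cc vC.
exists (fun x => if x == v then u else if x == u then v else M x) => x.
rewrite !inE fu; have [->|xv] := eqVneq x v => [_|].
  by rewrite !eqxx orbT eq_sym (negbTE vu).
have [->|xu] := eqVneq x u => [_|].
  by rewrite vC eqxx e_sym.
rewrite (inj_eq (@Some_inj _)) eq_sym (negbTE xu) orbF => xC.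
have [|/setD1P[Mv MC] MM eM] := HM x; first by rewrite !inE xv.
rewrite MC (negbTE Mv) MM; split=> //; case: eqP => // Mu.
by rewrite -Mu MC in uC.
Qed.
End Tutte.

(** * Matchings in enlarged line graphs *)

Lemma sum_le1 (I : finType) (c : {set I}) (p : pred I) :
  {in c &, forall i j, p i -> p j -> i = j} -> \sum_(i in c) p i <= 1.
Proof.
move=> H; have -> : \sum_(i in c) p i = #|[set i in c | p i]|.
  rewrite -sum1_card [in LHS]big_mkcond [in RHS]big_mkcond /=.
  by apply: eq_bigr => i _; rewrite inE; case: (i \in c); case: (p i).
apply/card_le1_eqP => i j; rewrite !inE => /andP[ic pi] /andP[jc pj].
exact: H.
Qed.

Lemma card_le_sum (I : finType) (A S : {set I}) (g : I -> nat) :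
  S \subset A -> {in S, forall i, 0 < g i} -> #|S| <= \sum_(i in A) g i.
Proof.
move=> /subsetP SA gS; rewrite -sum1_card big_mkcond [leqRHS]big_mkcond.
by apply: leq_sum => i _; case: ifP => // iS; rewrite SA // gS.
Qed.

Section Incidence.
Variables (Z L V : finType) (xl : Z -> L) (vl : Z -> V) (Q : {set L}).
Hypothesis even_vl : forall v, ~~ odd #|[set z | vl z == v]|.
Hypothesis card_xl : {in Q, forall q, 2 < #|[set z | xl z == q]|}.
(** [P] and [R] form one side of a cut, and the edges counted are those of the cut. Taking the side
    that contains the [V]-end of a bridge, one may assume that no edge of the cut starts in [P]. *)
Hypothesis bridgeless : forall (P : {set L}) (R : {set V}),
  (forall z, xl z \in P -> vl z \in R) ->
  #|[set z | (vl z \in R) && (xl z \notin P)]| != 1.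

(* The line graph of the bipartite multigraph with edge set Z and end maps xl, vl,
   with two more vertices inr (q, b) for each q in Q; these have to be matched to
   edges at q. *)
Definition gadget_adj : rel (Z + L * bool) := fun a b =>
  match a, b with
  | inl z, inl z' => (z != z') && ((xl z == xl z') || (vl z == vl z'))
  | inl z, inr (q, _) | inr (q, _), inl z => xl z == q
  | inr _, inr _ => false
  end.

Definition gadget : {set Z + L * bool} :=
  [set a | if a is inr (q, _) then q \in Q else true].

Lemma gadget_adj_sym : symmetric gadget_adj.
Proof.
by move=> [z|[q b]] [z'|[q' b']] //=; rewrite eq_sym (eq_sym (xl _)) (eq_sym (vl _)).
Qed.

(** The extra vertices come in pairs and do not affect parity. *)
Lemma odd_card_gadget (C : {set Z + L * bool}) (P : {set L}) :
  (forall q b, (inr (q, b) \in C) = (q \in P)) ->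
  odd #|[set z | inl z \in C]| = odd #|C|.
Proof.
move=> CP; pose Cq := setX P [set: bool].
have -> : C = (@inl Z (L * bool) @: [set z | inl z \in C]) :|: (@inr Z (L * bool) @: Cq).
  apply/setP=> -[z|[q b]]; rewrite inE.
    rewrite mem_imset ?inE; last by move=> ? ? [].
    by rewrite orbC; case: imsetP => // -[].
  rewrite (mem_imset _ _ (@inr_inj _ _)) !inE andbT CP.
  by case: imsetP => // -[].
rewrite cardsU disjoint_setI0; last first.
  rewrite disjoint_subset; apply/subsetP => _ /imsetP[z _ ->].
  by rewrite inE; apply/negP => /imsetP[].
rewrite cards0 subn0 (card_imset _ (@inl_inj _ _)) (card_imset _ (@inr_inj _ _)).
rewrite cardsX cardsT card_bool oddD oddM andbF addbF; congr odd; apply: eq_card => z.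
rewrite !inE mem_imset ?inE; last by move=> ? ? [].
by rewrite orbC; case: imsetP => // -[].
Qed.

Section Charge.
Variables (U : {set Z + L * bool}) (c : {set {set Z + L * bool}}).
Hypotheses (sU : U \subset gadget) (Hc : odd_family gadget_adj gadget U c).
Implicit Types C D : {set Z + L * bool}.

Let tI : {in c &, forall C D a, a \in C -> a \in D -> C = D}.
Proof. by have /odd_familyP[] := Hc. Qed.

Let inC C a : C \in c -> a \in C -> a \in gadget /\ a \notin U.
Proof.
have /odd_familyP[_ H] := Hc.
by move=> Cc aC; have [_ /subsetP/(_ a aC)/setDP] := H C Cc.
Qed.

Let nC C a b : C \in c -> a \in C -> gadget_adj a b -> b \in gadget ->
  b \notin U -> b \in C.
Proof.
have /odd_familyP[_ H] := Hc.
move=> Cc aC ab bg bU; have [_ _ /(_ a b aC bg ab)] := H C Cc.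
by rewrite inE (negbTE bU) orbF.
Qed.

Let inl_gadget z : inl z \in gadget. Proof. by rewrite inE. Qed.

Let cx C := [set xl z | z in [set z | inl z \in C]].
Let cv C := [set vl z | z in [set z | inl z \in C]].
Let dead x := [forall z, (xl z == x) ==> (inl z \in U)].

(* Charges are in thirds.  If all edges at q are deleted, the extra vertices
   inr (q, b) become isolated and the 2/3 sent to q is shared between them. *)
Let charge (a : Z + L * bool) C : nat :=
  match a with
  | inl z => (if dead (xl z) then \sum_(b : bool) (inr (xl z, b) \in C)
              else (xl z \in cx C) * 2) + (vl z \in cv C)
  | inr (q, _) => (q \in cx C) * 3
  end.

Let cxP C x : reflect (exists2 z, inl z \in C & xl z = x) (x \in cx C).
Proof.
apply: (iffP imsetP) => [[z]|[z zC <-]]; first by rewrite inE => zC ->; exists z.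
by exists z; rewrite ?inE.
Qed.

Let cvP C v : reflect (exists2 z, inl z \in C & vl z = v) (v \in cv C).
Proof.
apply: (iffP imsetP) => [[z]|[z zC <-]]; first by rewrite inE => zC ->; exists z.
by exists z; rewrite ?inE.
Qed.

Let adj_same C z z' : C \in c -> inl z \in C -> inl z' \notin U ->
  (xl z == xl z') || (vl z == vl z') -> inl z' \in C.
Proof.
move=> Cc zC z'U H; have [<-//|zz'] := eqVneq z z'.
by apply: (nC Cc zC) => //=; rewrite zz'.
Qed.

(** Undeleted edges with a common end are pairwise adjacent, so only one member can contain any of
    them. *)
Let cx_inj x : {in c &, forall C D, x \in cx C -> x \in cx D -> C = D}.
Proof.
move=> C D Cc Dc /cxP[z zC zx] /cxP[z' z'D z'x].
apply: (tI Cc Dc (a := inl z')) => //.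
apply: (adj_same Cc zC); last by rewrite zx z'x eqxx.
by have [] := inC Dc z'D.
Qed.

Let cv_inj v : {in c &, forall C D, v \in cv C -> v \in cv D -> C = D}.
Proof.
move=> C D Cc Dc /cvP[z zC zx] /cvP[z' z'D z'x].
apply: (tI Cc Dc (a := inl z')) => //.
apply: (adj_same Cc zC); last by rewrite zx z'x eqxx orbT.
by have [] := inC Dc z'D.
Qed.

(** At most 2 goes to the [xl] side and 1 to the [vl] side; at a dead [xl z] the 2 is made up of 1
    for each extra vertex. *)
Let charge_le a : \sum_(C in c) charge a C <= 3.
Proof.
case: a => [z|[q b]] /=; last first.
  by rewrite -big_distrl (leq_mul2r 3 _ 1) sum_le1 //=; apply: cx_inj.
rewrite big_split; apply: (@leq_add _ _ 2 1); last first.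
  by apply: sum_le1; apply: cv_inj.
case: (dead (xl z)) => /=; last first.
  by rewrite -big_distrl (leq_mul2r 2 _ 1) sum_le1 //=; apply: cx_inj.
rewrite exchange_big; apply: leq_trans (_ : \sum_(b : bool) 1 <= 2).
  by apply: leq_sum => b _; apply: sum_le1 => C D Cc Dc; apply: tI.
by rewrite sum1_card card_bool.
Qed.

Let charge_ge C : C \in c -> 3 <= \sum_(a in U) charge a C.
Proof.
move=> Cc; have big1_ge (a : Z + L * bool) :
    a \in U -> 3 <= charge a C -> 3 <= \sum_(a in U) charge a C.
  by move=> aU le; rewrite (bigD1 a) //=; apply: leq_trans le (leq_addr _ _).
(* An isolated extra vertex receives 1 from each of the at least three edges at [q]. *)
have [/existsP[[q b] /andP[qC dq]]|] :=
    boolP [exists qb : L * bool, (inr qb \in C) && dead qb.1].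
  have qQ : q \in Q by have [] := inC Cc qC; rewrite inE.
  apply: leq_trans (card_xl qQ) _.
  rewrite -(card_imset _ (@inl_inj Z (L * bool)%type)); apply: card_le_sum.
    apply/subsetP => _ /imsetP[z + ->]; rewrite inE => zq.
    by have /forallP/(_ z)/implyP := dq; apply.
  move=> _ /imsetP[z + ->]; rewrite inE => /eqP zq /=.
  by rewrite zq dq (bigD1 b) //= qC.
rewrite negb_exists => /forallP live.
have [/existsP[[q b] /andP[qU qC]]|] :=
    boolP [exists qb : L * bool, (inr qb \in U) && (qb.1 \in cx C)].
  by apply: (big1_ge _ qU) => /=; move: qC => /= ->.
rewrite negb_exists => /forallP aU.
pose Cz := [set z | inl z \in C].
(* With the two cases above gone, [C] contains both extra vertices at [q] or neither, so the number
   of its edges is odd. *)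
have inrC q b : (inr (q, b) \in C) = (q \in Q) && (q \in cx C).
  apply/idP/andP => [qC|[qQ /cxP[z zC zq]]].
    have [] := inC Cc qC; rewrite inE => qQ _; split=> //.
    have := live (q, b); rewrite qC /= negb_forall => /existsP[z].
    rewrite negb_imply => /andP[zq zU].
    by apply/cxP; exists z; [apply: (nC Cc qC); rewrite //= ?inE | apply/eqP].
  apply: (nC Cc zC); rewrite //= ?zq ?inE //.
  by have := aU (q, b); rewrite negb_and /= => /orP[//|/cxP[]]; exists z.
have oddCz : odd #|Cz|.
  have /odd_familyP[_ /(_ C Cc)[oC _ _]] := Hc.
  suff <- : odd #|C| = odd #|Cz| by [].
  by apply/esym/(odd_card_gadget (P := Q :&: cx C)) => q b; rewrite inrC inE.
(* These are the deleted edges at vertices met by [C]. Their number is odd, as the fibres of [vl]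
   are even. Each gives at least 1, so three suffice. *)
pose W := [set z | (vl z \in cv C) && (inl z \notin C)].
have WU z : z \in W -> inl z \in U.
  rewrite inE => /andP[/cvP[z' z'C vz] zC].
  apply: contraNT zC => zU; apply: (adj_same Cc z'C zU).
  by rewrite vz eqxx orbT.
have oddW : odd #|W|.
  have : ~~ odd #|[set z | vl z \in cv C]|.
    have -> : #|[set z | vl z \in cv C]| = \sum_(v in cv C) #|[set z | vl z == v]|.
      rewrite -sum1_card (partition_big vl (mem (cv C))) => [|z]; last by rewrite inE.
      apply: eq_bigr => v vC; rewrite -sum1_card; apply: eq_bigl => z.
      by rewrite !inE andbC; case: (vl z =P v) => //= ->.
    apply: (big_ind (fun m => ~~ odd m)) => // m n.
    by rewrite oddD => /negbTE-> /negbTE->.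
  have -> : [set z | vl z \in cv C] = Cz :|: W.
    apply/setP=> z; rewrite !inE; case: (boolP (inl z \in C)) => /= [zC|]; last by rewrite andbT.
    by apply/cvP; exists z.
  rewrite cardsU disjoint_setI0.
    by rewrite cards0 subn0 oddD oddCz; case: odd.
  by rewrite disjoint_subset; apply/subsetP => z; rewrite !inE => ->; rewrite andbF.
have Wc z : z \in W -> 0 < charge (inl z) C.
  by rewrite inE => /andP[vC _] /=; rewrite vC addn1.
have [W3|] := leqP 3 #|W|.
  rewrite -(card_imset _ (@inl_inj Z (L * bool)%type)) in W3.
  apply: leq_trans W3 _; apply: card_le_sum.
    by apply/subsetP => _ /imsetP[z /WU + ->].
  by move=> _ /imsetP[z /Wc + ->].
move=> W3; have /cards1P[z0 Wz0] : #|W| == 1.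
  by case: #|W| oddW W3 => [|[|[|]]].
have z0W : z0 \in W by rewrite Wz0 set11.
have ndead z : xl z \in cx C -> dead (xl z) = false.
  move=> /cxP[z' z'C z'x]; apply/negP => /forallP/(_ z').
  rewrite z'x eqxx /=; apply/negP; by have [] := inC Cc z'C.
case: (boolP (xl z0 \in cx C)) => [z0x|z0x].
  apply: (big1_ge _ (WU _ z0W)) => /=; rewrite ndead // z0x.
  by move: z0W; rewrite inE => /andP[-> _].
(* If all edges at [cx C] ended in [cv C], then [z0] would be a bridge. So some [z] at [cx C] ends
   elsewhere; it is deleted and gives 2, to which [z0] adds 1. *)
have [] : exists2 z, xl z \in cx C & vl z \notin cv C.
  apply/exists_inP; apply: contraT; rewrite negb_exists => /forallP H.
  have : #|[set z | (vl z \in cv C) && (xl z \notin cx C)]| != 1.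
    apply: bridgeless => z zx; have := H z.
    by rewrite negb_and zx /= negbK.
  suff -> : [set z | (vl z \in cv C) && (xl z \notin cx C)] = [set z0].
    by rewrite cards1.
  apply/eqP; rewrite eqEsubset; apply/andP; split.
    rewrite -Wz0; apply/subsetP => z; rewrite !inE => /andP[-> /=].
    by apply: contraNN => zC; apply/cxP; exists z.
  rewrite sub1set inE z0x andbT.
  by move: z0W; rewrite inE => /andP[].
move=> z zx zv; have zU : inl z \in U.
  apply: contraNT zv => zU; apply/cvP; exists z => //.
  case/cxP: zx => z' z'C z'x; apply: (adj_same Cc z'C zU).
  by rewrite z'x eqxx.
have zz0 : z != z0 by apply: contraNneq z0x => <-.
rewrite (bigD1 (inl z)) //= (bigD1 (inl z0)) /=; last first.
  by rewrite WU // eq_sym.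
apply: (@leq_add 2 1); last by apply: leq_trans (Wc z0 z0W) (leq_addr _ _).
by rewrite /= (ndead z zx) zx.
Qed.

Lemma odd_family_le : #|c| <= #|U|.
Proof.
rewrite -(leq_pmul2r (isT : 0 < 3)) -!sum_nat_const.
apply: (@leq_trans (\sum_(C in c) \sum_(a in U) charge a C)).
  by apply: leq_sum => C; apply: charge_ge.
by rewrite exchange_big; apply: leq_sum => a _; apply: charge_le.
Qed.
End Charge.

Lemma gadget_matching : exists M, matching gadget_adj gadget M.
Proof. by apply: (tutte gadget_adj_sym) => U c sU Hc; apply: odd_family_le. Qed.

(** [J] consists of the edges matched to an edge with a different [xl], hence with the same [vl].
    The other edges at [x] are matched among themselves and with the extra vertices at [x], which
    gives evenness; an edge matched to an extra vertex at [q] is outside [J]. *)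
Lemma incidence_selection : exists (J : {set Z}) (M : Z -> Z),
  [/\ {in J, forall z, [/\ M z \in J, M (M z) = z, M z != z & vl (M z) = vl z]},
      forall x, ~~ odd #|[set z | xl z == x] :\: J| &
      {in Q, forall q, exists2 z, xl z = q & z \notin J}].
Proof.
have [G HG] := gadget_matching.
have inlG z : inl z \in gadget by rewrite inE.
pose J := [set z | if G (inl z) is inl z' then xl z' != xl z else false].
exists J, (fun z => if G (inl z) is inl z' then z' else z); split.
- move=> z; rewrite inE; have := HG _ (inlG z).
  case Gz : (G (inl z)) => [z'|//] [_ GG /=].
  rewrite GG inE GG => /andP[zz'] /orP[/eqP xz|/eqP vz] xz'.
    by rewrite xz eqxx in xz'.
  by split; rewrite // eq_sym.
- move=> x.
  pose D := [set a : Z + L * bool | match a with inl z => (xl z == x) && (z \notin J)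
                   | inr (q, _) => (q == x) && (q \in Q) end].
  have -> : [set z | xl z == x] :\: J = [set z | inl z \in D].
    by apply/setP=> z; rewrite !inE andbC.
  rewrite (@odd_card_gadget _ ([set x] :&: Q)); last by move=> q b; rewrite !inE.
  apply: (@even_involution _ _ G) => a aD.
  have ag : a \in gadget.
    by move: aD; rewrite !inE; case: a => [//|[q b]] /andP[].
  have [Gg GG adj] := HG a ag; split=> //; last first.
    by apply: contraTneq adj => ->; case: (a) => [z|[q b]] //=; rewrite eqxx.
  case: a aD ag Gg GG adj => [z|[q b]].
    rewrite !inE => /andP[/eqP zx zJ] _.
    case Gz : (G (inl z)) zJ => [z'|[q b]] /=.
      rewrite negbK => /eqP z'z _ GG _.
      by rewrite inE GG z'z zx !eqxx.
    by move=> _ -> _; rewrite zx eq_sym => ->.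
  rewrite !inE => /andP[/eqP -> xQ] _.
  case: (G _) => [z'|[]] //= _ GG /eqP z'x.
  by rewrite z'x eqxx inE GG.
- move=> q qQ; have qg : inr (q, true) \in gadget by rewrite inE.
  have [_] := HG _ qg; case Gq : (G (inr (q, true))) => [z|[]] //= Gz /eqP zq.
  by exists z; rewrite // inE Gz.
Qed.
End Incidence.

(** * Colouring by linear algebra over F_2 *)

Section Fredholm.
Local Open Scope ring_scope.
Lemma fredholm (F : fieldType) (I K : finType) (a : I -> K -> F) (b : K -> F) :
  (forall y : K -> F, (forall i, \sum_k a i k * y k = 0) -> \sum_k b k * y k = 0) ->
  exists c : I -> F, forall k, \sum_i c i * a i k = b k.
Proof.
move=> H.
pose A := \matrix_(i < #|I|, k < #|K|) a (enum_val i) (enum_val k).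
pose B := \row_(k < #|K|) b (enum_val k).
have sumE (T : finType) (f : T -> F) : \sum_(i < #|T|) f (enum_val i) = \sum_i f i.
  by rewrite -(big_enum_val (A := T) f); apply: eq_bigl.
(* [B] is in the row space once every column of the cokernel kills it, and each such column is an
   admissible [y]. *)
have /submxP[c BE] : (B <= A)%MS.
  rewrite submxE; apply/eqP/rowP => j; rewrite !mxE.
  rewrite -[RHS](H (fun k => cokermx A (enum_rank k) j)) => [|i].
    by rewrite -[RHS]sumE; apply: eq_bigr => k _; rewrite [B _ _]mxE enum_valK.
  have /matrixP/(_ (enum_rank i) j) := mulmx_coker A.
  rewrite !mxE => coker0; rewrite -[RHS]coker0 -[LHS]sumE; apply: eq_bigr => k _.
  by rewrite [A _ _]mxE enum_valK enum_rankK.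
exists (fun i => c 0 (enum_rank i)) => k.
have /rowP/(_ (enum_rank k)) := BE; rewrite !mxE enum_rankK => ->.
by rewrite -[LHS]sumE; apply: eq_bigr => i _; rewrite [A _ _]mxE enum_valK enum_rankK.
Qed.

Lemma natrF2 n : n%:R = (odd n)%:R :> 'F_2.
Proof.
rewrite -{1}(odd_double_half n) natrD -muln2 natrM.
by rewrite (_ : 2%:R = 0) ?mulr0 ?addr0 //; apply: val_inj.
Qed.

Lemma F2_addrr (x : 'F_2) : x + x = 0.
Proof. by rewrite -mulr2n -mulr_natr natrF2 mulr0. Qed.

Lemma F2_neq0 (x : 'F_2) : x = (x != 0)%:R.
Proof. by case: x => -[|[|//]] i; apply: val_inj. Qed.

Lemma sum_F2 (I : finType) (A : {set I}) (f : I -> 'F_2) :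
  \sum_(i in A) f i = (odd #|[set i in A | f i != 0]|)%:R.
Proof.
rewrite -natrF2 -sum1_card natr_sum [RHS]big_mkcond [LHS]big_mkcond.
by apply: eq_bigr => i _; rewrite inE; case: ifP => //= _; rewrite {1}[f i]F2_neq0; case: eqP.
Qed.

End Fredholm.

Section Colouring.
Local Open Scope ring_scope.
Variables (E L Z : finType) (p q : Z -> E) (el : E -> L) (J0 : {set Z}) (M : Z -> Z).
Hypothesis el_q : forall z, el (q z) = el (p z).
Hypothesis HM : {in J0, forall z, [/\ M z \in J0, M (M z) = z & M z != z]}.
Hypothesis even_compl : forall x, ~~ odd #|[set z | el (p z) == x] :\: J0|.
(** This is how connectedness of a trail enters: around a closed trail, the equation at [e] equates
    the values of the two transitions using [e]. *)
Hypothesis el_connected : forall y : Z -> 'F_2,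
  (forall e, \sum_z ((p z == e)%:R + (q z == e)%:R) * y z = 0) ->
  forall z z', el (p z) = el (p z') -> y z = y z'.

Let admissible (J : {set Z}) := [&& J \subset J0, [forall z in J, M z \in J] &
  [forall x, ~~ odd #|[set z | el (p z) == x] :\: J|]].

(** For a smallest admissible [J], removing such a [K] would add an even number of transitions to
    the complement on each trail, so [J :\: K] would be admissible as well. *)
Lemma minimal_admissible : exists2 J, admissible J &
  forall K : {set Z}, K \subset J -> {in K, forall z, M z \in K} ->
  (forall x, ~~ odd #|[set z in K | el (p z) == x]|) -> K = set0.
Proof.
have adm0 : admissible J0.
  rewrite /admissible subxx /=; apply/andP; split; last exact/forallP.
  by apply/forall_inP => z /HM[].
case: (arg_minnP (fun J : {set Z} => #|J|) adm0) => J admJ minJ.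
exists J => // K sKJ MK evK; have /and3P[sJ /forall_inP MJ /forallP evJ] := admJ.
apply/eqP; rewrite -cards_eq0.
have /minJ : admissible (J :\: K).
  apply/and3P; split; first exact: subset_trans (subsetDl _ _) sJ.
    apply/forall_inP => z; rewrite !inE => /andP[zK zJ]; rewrite MJ // andbT.
    apply: contraNN zK => /MK; have [_ -> _] := HM (subsetP sJ _ zJ).
    by [].
  apply/forallP => x; rewrite setDDr cardsU.
  have -> : ([set z | el (p z) == x] :\: J) :&: ([set z | el (p z) == x] :&: K) = set0.
    apply/setP=> z; rewrite !inE.
    by case: (boolP (z \in K)) => [/(subsetP sKJ)->|]; rewrite ?andbF.
  rewrite cards0 subn0 oddD (negbTE (evJ x)) /=.
  rewrite (_ : _ :&: K = [set z in K | el (p z) == x]) ?evK //.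
  by apply/setP=> z; rewrite !inE andbC.
rewrite cardsD (setIidPr sKJ) => le; rewrite -leqn0 -(leq_add2l (#|J| - #|K|)).
by rewrite subnK ?subset_leq_card // addn0.
Qed.

Lemma F2_add_neq0 (a b : 'F_2) : (a + b != 0) = (a != 0) (+) (b != 0).
Proof. by case: a b => -[|[|//]] ? [[|[|//]]] ?. Qed.

Lemma colouring : exists2 J : {set Z}, J \subset J0 & {in J, forall z, M z \in J} /\
  exists c : E -> bool, (forall z, z \notin J -> c (p z) != c (q z)) /\
    {in J, forall z, c (p z) = c (q z) /\ c (p (M z)) != c (p z)}.
Proof.
have [J /and3P[sJ /forall_inP MJ /forallP evJ] minJ] := minimal_admissible.
exists J => //; split=> //.
have MM z : z \in J -> M (M z) = z by move=> /(subsetP sJ)/HM[].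
have Mneq z : z \in J -> M z != z by move=> /(subsetP sJ)/HM[].
have sum_M (f : Z -> 'F_2) : \sum_(z in J) f (M z) = \sum_(z in J) f z.
  rewrite [RHS](reindex_onto M M) //; apply: eq_bigl => z; apply/idP/andP.
    by move=> zJ; rewrite MJ ?MM.
  by case=> MzJ /eqP <-; apply: MJ.
have sum_el (z : Z) (r : Z -> E) x :
  \sum_(e | el e == x) (r z == e)%:R = (el (r z) == x)%:R :> 'F_2.
  case: eqP => [rx|/eqP rx].
    rewrite (bigD1 (r z)) /= ?rx // eqxx big1 ?addr0 // => e /andP[_].
    by rewrite eq_sym => /negbTE->.
  by apply: big1 => e /eqP ex; case: eqP => // re; rewrite re ex eqxx in rx.
(* The unknowns are the colours. Equation [inl z] prescribes whether the colour changes at [z];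
   [inr z] makes [z] and [M z] opposite, and reads 0 = 0 for [z] outside [J]. *)
pose a e (k : Z + Z) : 'F_2 := match k with
  | inl z => (p z == e)%:R + (q z == e)%:R
  | inr z => (z \in J)%:R * ((p z == e)%:R + (p (M z) == e)%:R) end.
pose b (k : Z + Z) : 'F_2 := match k with
  | inl z => (z \notin J)%:R | inr z => (z \in J)%:R end.
have [y Hy|c Hc] := @fredholm _ _ _ a b.
  pose y0 z := y (inl z); pose y1 z := y (inr z).
  (* Both [z] and [M z] carry the equation of their pair; [w] adds the two multipliers. *)
  pose w z := (z \in J)%:R * (y1 z + y1 (M z)).
  have sum_in (f : Z -> 'F_2) : \sum_z (z \in J)%:R * f z = \sum_(z in J) f z.
    by rewrite [RHS]big_mkcond; apply: eq_bigr => z _; case: ifP; rewrite ?mul1r ?mul0r.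
  have stepA e : \sum_z a e (inr z) * y1 z = \sum_z (p z == e)%:R * w z.
    under eq_bigr do rewrite /= -mulrA mulrDl mulrDr.
    rewrite big_split /= !sum_in.
    have -> : \sum_(z in J) (p (M z) == e)%:R * y1 z = \sum_(z in J) (p z == e)%:R * y1 (M z).
      by rewrite -[RHS]sum_M; apply: eq_bigr => z zJ; rewrite MM.
    rewrite -big_split /= -sum_in; apply: eq_bigr => z _.
    by rewrite /w -mulrDr !mulrA [X in X * _]mulrC.
  have eqn e : \sum_z ((p z == e)%:R + (q z == e)%:R) * y0 z + \sum_z (p z == e)%:R * w z = 0.
    by rewrite -stepA; have := Hy e; rewrite big_sumType.
  (* Sum the equations over the edges of trail [x]: the [y0] terms cancel, since [p z] and [q z] lie
     on the same trail. *)
  have stepB x : \sum_(z | el (p z) == x) w z = 0.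
    have : \sum_(e | el e == x) (\sum_z ((p z == e)%:R + (q z == e)%:R) * y0 z
                               + \sum_z (p z == e)%:R * w z) = 0.
      by apply: big1 => e _; apply: eqn.
    rewrite big_split /= exchange_big /= big1 ?add0r => [|z _]; last first.
      by rewrite -mulr_suml big_split /= !sum_el el_q F2_addrr mul0r.
    rewrite exchange_big /= => sum0; rewrite -[RHS]sum0 [LHS]big_mkcond; apply: eq_bigr => z _.
    by rewrite -mulr_suml sum_el; case: ifP; rewrite ?mul1r ?mul0r.
  (* The support of [w] is a subset of [J] closed under [M] that meets each trail evenly, hence
     empty by minimality. *)
  have w0 z : w z = 0.
    apply/eqP; apply: contraT => wz.
    have : z \in [set z in J | w z != 0].
      by rewrite inE wz andbT; apply: contraNT wz => /negbTE zJ; rewrite /w zJ mul0r.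
    rewrite (minJ [set z in J | w z != 0]) ?inE //.
    - by apply/subsetP => z'; rewrite inE => /andP[].
    - move=> z'; rewrite !inE => /andP[zJ]; rewrite MJ //.
      by rewrite /w zJ MJ // MM // addrC.
    - move=> x; rewrite (_ : [set _ in _ | _] = [set z in [set z | el (p z) == x] | w z != 0]).
        have := stepB x; rewrite (eq_bigl (fun z => z \in [set z | el (p z) == x])); last first.
          by move=> z'; rewrite inE.
        by rewrite sum_F2; case: odd.
      apply/setP=> z'; rewrite !inE andbC; case: (_ == x) => //=.
      by case: (boolP (z' \in J)) => //= zJ; rewrite /w (negbTE zJ) mul0r eqxx.
  have y0c := el_connected (y := y0).
  have {}y0c : forall z z', el (p z) = el (p z') -> y0 z = y0 z'.
    apply: y0c => e; rewrite -[RHS](eqn e) [X in _ = _ + X]big1 ?addr0 // => z _.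
    by rewrite w0 mulr0.
  rewrite big_sumType /= sum_in.
  have -> : \sum_(z in J) y (inr z) = 0.
    rewrite sum_F2 (_ : odd _ = false) //; apply/negbTE.
    apply: (@even_involution _ _ M) => z; rewrite !inE => /andP[zJ yz].
    rewrite MJ // MM // Mneq //; split=> //=.
    have /eqP := w0 z; rewrite /w zJ mul1r => wz.
    by apply: contraNneq yz => yM; move: wz; rewrite /y1 yM addr0.
  (* Now [y0] is constant on each trail, and each trail has evenly many transitions outside [J]. *)
  rewrite addr0 (partition_big (fun z => el (p z)) xpredT) //= big1 // => x _.
  rewrite (eq_bigr (fun z => (z \notin J)%:R * y0 z)) //.
  have -> : \sum_(z | el (p z) == x) (z \notin J)%:R * y0 z
     = \sum_(z in [set z | el (p z) == x] :\: J) y0 z.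
    rewrite big_mkcond [RHS]big_mkcond; apply: eq_bigr => z _; rewrite !inE andbC.
    by case: (_ == x) => //=; case: (z \in J) => //=; rewrite ?mul1r ?mul0r.
  rewrite sum_F2 (_ : odd _ = false) //; apply/negbTE.
  have [z0|] := pickP [pred z in [set z | el (p z) == x] :\: J | y0 z != 0].
    rewrite !inE /= => /andP[/andP[_ /eqP z0x] yz0].
    rewrite (_ : [set _ in _ | _] = [set z | el (p z) == x] :\: J) ?evJ //.
    apply/setP=> z; rewrite !inE; case: (el (p z) =P x) => [zx|]; rewrite ?andbF //.
    by rewrite (y0c z z0) ?yz0 ?andbT // zx z0x.
  move=> none; rewrite (_ : [set _ in _ | _] = set0) ?cards0 //.
  by apply/setP=> z; have := none z; rewrite !inE /= => ->.
have sumc (e : E) : \sum_e' c e' * (e == e')%:R = c e.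
  rewrite (bigD1 e) //= eqxx mulr1 big1 ?addr0 // => e'.
  by rewrite eq_sym => /negbTE->; rewrite mulr0.
have Hl z : c (p z) + c (q z) = (z \notin J)%:R.
  transitivity (b (inl z)) => //; rewrite -(Hc (inl z)) /=; under [RHS]eq_bigr do rewrite mulrDr.
  by rewrite big_split /= !sumc.
have Hr z : z \in J -> c (p z) + c (p (M z)) = 1.
  move=> zJ; transitivity (b (inr z)); last by rewrite /b zJ.
  rewrite -(Hc (inr z)) /= zJ; under [RHS]eq_bigr do rewrite mul1r mulrDr.
  by rewrite big_split /= !sumc.
exists (fun e => c e != 0); split=> [z zJ|z zJ].
  have := F2_add_neq0 (c (p z)) (c (q z)); rewrite Hl zJ.
  by case: (c (p z) != 0); case: (c (q z) != 0).
have := F2_add_neq0 (c (p z)) (c (p (M z))); rewrite Hr //.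
have := F2_add_neq0 (c (p z)) (c (q z)); rewrite Hl zJ.
by case: (c (p z) != 0); case: (c (q z) != 0); case: (c (p (M z)) != 0).
Qed.
End Colouring.

(** * Transitions *)

(* H contains exactly one element of each pair {d, s d}. *)
Lemma pairing (D K : finType) (g : D -> K) :
  (forall k, ~~ odd #|[set d | g d == k]|) ->
  exists (s : D -> D) (H : {set D}),
    [/\ involutive s, forall d, g (s d) = g d & forall d, (s d \in H) = (d \notin H)].
Proof.
move=> even_g; pose cls d := enum [set x | g x == g d].
(* Positions 0 and 1, 2 and 3, and so on are exchanged; classes of even size keep the sibling in
   range. *)
pose sib i := if odd i then i.-1 else i.+1.
have sibK : involutive sib.
  by move=> i; rewrite /sib; case oi: (odd i); [case: i oi => //= i /negbTE-> | rewrite /= oi].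
have odd_sib i : odd (sib i) = ~~ odd i.
  by rewrite /sib; case oi: (odd i); [case: i oi => //= i /negbTE-> | rewrite /= oi].
have size_cls d : ~~ odd (size (cls d)) by rewrite -cardE.
have lt_idx d : index d (cls d) < size (cls d) by rewrite index_mem mem_enum inE.
have lt_sib d : sib (index d (cls d)) < size (cls d).
  move: (lt_idx d) (size_cls d); rewrite /sib; move: (index _ _) (size _) => i n lt ev.
  case: ifP => oi; first exact: leq_ltn_trans (leq_pred i) lt.
  by rewrite ltn_neqAle lt andbT; apply: contraNneq ev => <-; rewrite /= oi.
pose s d := nth d (cls d) (sib (index d (cls d))).
have gs d : g (s d) = g d.
  by have := mem_nth d (lt_sib d); rewrite mem_enum inE => /eqP.
have cls_s d : cls (s d) = cls d by rewrite /cls gs.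
have idx_s d : index (s d) (cls (s d)) = sib (index d (cls d)).
  by rewrite cls_s index_uniq // enum_uniq.
exists s, [set d | odd (index d (cls d))]; split=> // d; last first.
  by rewrite !inE idx_s odd_sib.
rewrite {1}/s idx_s sibK cls_s (set_nth_default d) ?nth_index //.
by rewrite mem_enum inE.
Qed.

Section Pairs.
Variables (D : finType) (s : D -> D) (H : {set D}).
Hypothesis sK : involutive s.
Hypothesis sH : forall d, (s d \in H) = (d \notin H).

Lemma big_pairs (R : Type) (idx : R) (op : Monoid.com_law idx) (F : D -> R) :
  \big[op/idx]_d F d =
  \big[op/idx]_(z : {d | d \in H}) op (F (val z)) (F (s (val z))).
Proof.
rewrite (bigID (mem H)) /= [X in op _ X](reindex_inj (inv_inj sK)) /=.
under [X in op _ X]eq_bigl do rewrite sH negbK.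
by rewrite -big_split /= (big_sub H).
Qed.

Lemma card_pairs (P : pred D) :
  #|[set d | P d]| = \sum_(z : {d | d \in H}) (P (val z) + P (s (val z))).
Proof.
rewrite -(big_pairs _ (fun d => nat_of_bool (P d))) -sum1_card big_mkcond.
by apply: eq_bigr => d _; rewrite inE; case: (P d).
Qed.
End Pairs.

Section Darts.
Variables (V E : finType) (ends : E -> V * V).
Hypothesis Hloop : loopless ends.

(* The pairs (e, false) and (e, true) are the two half-edges of e. *)
Definition base (d : E * bool) : V := if d.2 then (ends d.1).2 else (ends d.1).1.

Lemma base_opp e b : base (e, ~~ b) != base (e, b).
Proof. by case: b; rewrite /base /= ?[_ == (ends e).1]eq_sym Hloop. Qed.

Lemma incidentP e v : reflect (exists b, base (e, b) = v) (incident ends e v).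
Proof.
apply: (iffP orP) => [[] /eqP <-|[[] <-]]; rewrite /base /= ?eqxx; auto.
  by exists false.
by exists true.
Qed.

(** Without loops, an edge has at most one half-edge at [v]. *)
Lemma card_darts (S : {set E}) v :
  deg_in ends S v = #|[set d : E * bool | (d.1 \in S) && (base d == v)]|.
Proof.
rewrite -(card_in_imset (f := fst)).
  apply: eq_card => e; rewrite !inE; apply/andP/imsetP => [[eS /incidentP[b bv]]|].
    by exists (e, b); rewrite // inE /= eS bv eqxx.
  case=> [[e' b]]; rewrite inE /= => /andP[e'S /eqP bv] ->; split=> //.
  by apply/incidentP; exists b.
move=> [e b] [e' b']; rewrite !inE /= => /andP[_ /eqP bv] /andP[_ /eqP bv'] ee'.
rewrite ee' in bv *; have := base_opp e' b; rewrite bv -bv'.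
by case: b b' {bv bv'} => -[] //; rewrite eqxx.
Qed.

Lemma adj_darts x y : adj_in ends setT x y -> exists e b, base (e, b) = x /\ base (e, ~~ b) = y.
Proof.
case/exists_inP => e _ /orP[] /eqP Ee; [exists e, false | exists e, true];
  by rewrite /base /= Ee.
Qed.
End Darts.

Section Transitions.
Variables (V E : finType) (ends : E -> V * V) (t : nat).
Hypothesis Ht2 : 2 <= t.
Hypothesis Hloop : loopless ends.
Hypothesis Hreg : regular ends (2 * t).
Hypothesis H2c : two_connected ends.
Variables (s : E * bool -> E * bool) (H : {set E * bool}).
Hypothesis sK : involutive s.
Hypothesis s_base : forall d, base ends (s d) = base ends d.
Hypothesis sH : forall d, (s d \in H) = (d \notin H).

Notation base := (base ends).
Notation trans := {d : E * bool | d \in H}.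

Definition linked : rel E := fun e f => [exists b, (s (e, b)).1 == f].
(** A trail is named by a canonical edge of its component, so [E] serves as the set of trails; edges
    that are not roots name empty trails. *)
Definition trail (e : E) : E := fingraph.root linked e.

Definition fst_edge (z : trans) : E := (val z).1.
Definition snd_edge (z : trans) : E := (s (val z)).1.
Definition pivot (z : trans) : V := base (val z).

Lemma linked_connect_sym : connect_sym linked.
Proof.
apply: sym_connect_sym => e f.
suff imp e' f' : linked e' f' -> linked f' e' by apply/idP/idP; apply: imp.
case/existsP => b /eqP <-; apply/existsP; exists (s (e', b)).2.
by rewrite -surjective_pairing sK.
Qed.

Lemma trail_s d : trail (s d).1 = trail d.1.
Proof.
apply/eqP; rewrite eq_sym root_connect; last exact: linked_connect_sym.
apply: connect1; apply/existsP; exists d.2.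
by rewrite -surjective_pairing.
Qed.

Lemma s_neq d : s d != d.
Proof. by apply/eqP => sd; have := sH d; rewrite sd; case: (_ \in _). Qed.

Lemma s_edge d : (s d).1 != d.1.
Proof.
apply/eqP => sd; have := s_neq d; have := s_base d.
case: d sd => e b; case: (s _) => f b' /= ->.
case: (b' =P b) => [->|/eqP b'b]; first by rewrite eqxx.
have -> : b' = ~~ b by case: b b' b'b => -[].
by move=> bb; have := base_opp Hloop e b; rewrite bb eqxx.
Qed.

Lemma card_trans (P : pred trans) : #|[set z | P z]| = \sum_z P z.
Proof.
rewrite -sum1_card big_mkcond; apply: eq_bigr => z _.
by rewrite inE; case: (P z).
Qed.

Lemma card_pivot v : #|[set z | pivot z == v]| = t.
Proof.
apply/eqP; rewrite -(eqn_pmul2l (isT : 0 < 2)) -(Hreg v) card_darts //.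
have -> : [set d | (d.1 \in setT) && (base d == v)] = [set d | base d == v].
  by apply/setP=> d; rewrite !inE.
rewrite (card_pairs sK sH) card_trans mulnC big_distrl /=.
by apply/eqP/eq_bigr => z _; rewrite s_base muln2 addnn.
Qed.

(** The half-edges of a trail are counted twice: two per transition and two per edge. *)
Lemma card_trail x :
  #|[set z | trail (fst_edge z) == x]| = #|[set e | trail e == x]|.
Proof.
apply/eqP; rewrite -(eqn_pmul2l (isT : 0 < 2)) card_trans mulnC big_distrl /=.
under eq_bigr => z _ do rewrite muln2 -addnn -{2}/(fst_edge z).
have -> : \sum_z ((trail (fst_edge z) == x) + (trail (fst_edge z) == x)) =
          #|[set d : E * bool | trail d.1 == x]|.
  by rewrite (card_pairs sK sH); apply: eq_bigr => z _; rewrite trail_s.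
rewrite (_ : [set d | _] = setX [set e | trail e == x] setT).
  by rewrite cardsX cardsT card_bool mulnC.
by apply/setP=> d; rewrite !inE andbT.
Qed.

(** Looplessness rules out a trail with a single edge. *)
Lemma odd_trail_card x : odd #|[set z | trail (fst_edge z) == x]| ->
  2 < #|[set z | trail (fst_edge z) == x]|.
Proof.
rewrite card_trail => oddx; rewrite ltn_neqAle; apply/andP; split.
  by apply: contraTneq oddx => <-.
have /card_gt0P[e] : 0 < #|[set e | trail e == x]| by case: #|_| oddx.
rewrite inE => /eqP ex.
rewrite (cardsD1 e) inE ex eqxx (cardsD1 (s (e, true)).1) !inE.
by rewrite trail_s ex eqxx s_edge.
Qed.

(* The cut vertex that a bridge of the transition graph would produce is the
   pivot of that bridge. *)
Lemma transition_bridgeless (P : {set E}) (R : {set V}) :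
  (forall z, trail (fst_edge z) \in P -> pivot z \in R) ->
  #|[set z | (pivot z \in R) && (trail (fst_edge z) \notin P)]| != 1.
Proof.
move=> PR; apply/negP => /cards1P[z0 Hz0].
have PR' d : trail d.1 \in P -> base d \in R.
  move=> dP; case: (boolP (d \in H)) => dH; first exact: (PR (Sub d dH)).
  rewrite -sH in dH; rewrite -s_base; apply: (PR (Sub (s d) dH)).
  by rewrite /fst_edge SubK trail_s.
pose d0 := val z0.
(* The only half-edges at [R] on a trail outside [P] are the two of the bridge [z0]. *)
have Hd0 d : base d \in R -> trail d.1 \notin P -> d = d0 \/ d = s d0.
  move=> dR dP; have Hz (z : trans) : (pivot z \in R) && (trail (fst_edge z) \notin P) -> z = z0.
    by move=> Hz; apply/set1P; rewrite -Hz0 inE.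
  case: (boolP (d \in H)) => dH.
    by left; rewrite /d0 -(Hz (Sub d dH)) // /fst_edge /pivot SubK dR.
  right; rewrite -sH in dH; rewrite /d0 -(Hz (Sub (s d) dH)) ?sK //.
  by rewrite /fst_edge /pivot SubK s_base dR trail_s.
have := set11 z0; rewrite -Hz0 inE => /andP[v0R d0P].
pose v0 := pivot z0.
have Hv0 d : base d \in R -> base d != v0 -> trail d.1 \in P.
  move=> dR dv0; apply: contraNT dv0 => /(Hd0 d dR)[] ->; rewrite ?s_base //.
pose opp (d : E * bool) := (d.1, ~~ d.2).
have base_opp' d : base (opp d) != base d by case: d => e b; apply: base_opp.
have wv0 : base (opp d0) != v0 by apply: base_opp'.
have wR : base (opp d0) \notin R.
  by apply/negP => wR; have := Hv0 (opp d0) wR wv0; apply/negP.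
(* As [t] is at least 2, another transition [z1] meets [v0]. Its trail is in [P], which supplies a
   vertex [u] of [R] other than [v0]. *)
have [z1] : exists z1, (pivot z1 == v0) && (z1 != z0).
  have : 0 < #|[set z | pivot z == v0] :\ z0|.
    have := card_pivot v0; rewrite (cardsD1 z0) inE eqxx /= => cv0.
    by move: Ht2; rewrite -cv0 add1n.
  by case/card_gt0P => z1; rewrite !inE => /andP[? ?]; exists z1; apply/andP.
case/andP=> /eqP z1v0 z10.
have z1P : trail (fst_edge z1) \in P.
  apply: contraNT z10 => z1P; rewrite -in_set1 -Hz0 inE z1P andbT.
  by rewrite z1v0.
pose u := base (opp (val z1)).
have uv0 : u != v0 by rewrite -z1v0; apply: base_opp'.
have uR : u \in R by apply: PR'.
have [_ /(_ v0 u _ uv0 wv0)] := H2c.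
move/(closed_connect (a := mem R)); rewrite uR (negbTE wR).
(* No edge avoiding [v0] leaves [R], so deleting [v0] separates [u] from the far end of [d0]. *)
have closR e b : base (e, b) != v0 -> base (e, b) \in R -> base (e, ~~ b) \in R.
  by move=> ev0 eR; apply: PR'; apply: (Hv0 (e, b)).
suff clos : closed (adj_del ends v0) (mem R) by move/(_ clos).
move=> x y /and3P[xv0 yv0 /adj_darts[e [b [xE yE]]]].
apply/idP/idP => [xR|yR].
  by rewrite -yE; apply: closR; rewrite xE.
by rewrite -xE -(negbK b); apply: closR; rewrite yE.
Qed.

(** Extend [y] to half-edges by giving both halves of a transition its value. The equation at [e]
    says that the two half-edges of [e] agree, so the value propagates along the trail. *)
Lemma transitions_connected (y : trans -> 'F_2) :
  (forall e, \sum_z ((fst_edge z == e)%:R + (snd_edge z == e)%:R) * y z = 0)%R ->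
  forall z z', trail (fst_edge z) = trail (fst_edge z') -> y z = y z'.
Proof.
move=> y0.
pose ye d := if insub d is Some z then y z
             else if insub (s d) is Some z then y z else 0%R.
have ye_val z : ye (val z) = y z by rewrite /ye valK.
have ye_s_val z : ye (s (val z)) = y z.
  by rewrite /ye insubN ?sH ?(valP z) // sK valK.
have ye_s d : ye (s d) = ye d.
  case: (boolP (d \in H)) => dH.
    by have := ye_s_val (Sub d dH); rewrite -ye_val SubK.
  rewrite -sH in dH; have := ye_s_val (Sub (s d) dH).
  by rewrite -ye_val SubK sK.
have ye_edge e : ye (e, true) = ye (e, false).
  have := y0 e.
  under eq_bigr => z _ do rewrite mulrDl -{1}(ye_val z) -(ye_s_val z).
  rewrite -(big_pairs sK sH _ (fun d => (d.1 == e)%:R * ye d)%R).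
  rewrite (_ : \sum_d _ = \sum_f \sum_b (f == e)%:R * ye (f, b))%R; last first.
    by rewrite pair_bigA; apply: eq_bigr => -[].
  rewrite (bigD1 e) //=.
  rewrite [X in (_ + X)%R]big1 => [|f /negbTE fe]; last first.
    by rewrite fe big1 // => b _; rewrite mul0r.
  rewrite addr0 big_bool eqxx !mul1r => sum0.
  by rewrite -[LHS]addr0 -(F2_addrr (ye (e, false))) addrA sum0 add0r.
have ye_fst d : ye d = ye (d.1, true) by case: d => e [] //=; rewrite ye_edge.
move=> z z' /eqP; rewrite root_connect; last exact: linked_connect_sym.
move/(closed_connect (a := [pred e | ye (e, true) == y z])).
rewrite !inE /fst_edge -!ye_fst !ye_val eqxx => clos; apply/esym/eqP; rewrite -clos //.
move=> e f /existsP[b /eqP <-]; rewrite !inE -ye_fst ye_s.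
by rewrite [ye (e, b)]ye_fst.
Qed.

(** At [v], a transition outside [J] has one coloured half-edge, and two partners in [J] have two
    and none. The average is one per transition, and there are [t] transitions at [v]. *)
Lemma balanced_factor (J : {set trans}) (M : trans -> trans) (c : E -> bool) :
  {in J, forall z, [/\ M z \in J, M (M z) = z & pivot (M z) = pivot z]} ->
  (forall z, z \notin J -> c (fst_edge z) != c (snd_edge z)) ->
  {in J, forall z, c (fst_edge z) = c (snd_edge z) /\ c (fst_edge (M z)) != c (fst_edge z)} ->
  is_factor ends t [set e | c e].
Proof.
move=> HM cN cJ v; rewrite card_darts //.
have -> : [set d | (d.1 \in [set e | c e]) && (base d == v)] = [set d | c d.1 && (base d == v)].
  by apply/setP=> d; rewrite !inE.
rewrite (card_pairs sK sH) -(card_pivot v) card_trans.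
transitivity (\sum_z ((c (fst_edge z) && (pivot z == v)) + (c (snd_edge z) && (pivot z == v)))).
  by apply: eq_bigr => z _; rewrite s_base.
rewrite (bigID (mem J)) [RHS](bigID (mem J)) /=; congr (_ + _); last first.
  apply: eq_bigr => z /cN.
  by case: (c _); case: (c _) => //; rewrite ?addn0.
under eq_bigr => z zJ do rewrite -(cJ z zJ).1.
rewrite big_split /=.
have {2}-> : \sum_(z in J) (c (fst_edge z) && (pivot z == v)) =
         \sum_(z in J) (~~ c (fst_edge z) && (pivot z == v)).
  rewrite (reindex_onto M M) /=; last by move=> z /HM[].
  transitivity (\sum_(z in J) (c (fst_edge (M z)) && (pivot (M z) == v))).
    apply: eq_bigl => z; apply/andP/idP => [[MJ /eqP <-]|zJ]; first by have [] := HM _ MJ.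
    by have [-> -> _] := HM _ zJ.
  apply: eq_bigr => z zJ; have [_ _ ->] := HM _ zJ; have [_] := cJ _ zJ.
  by case: (c _); case: (c _).
rewrite -big_split; apply: eq_bigr => z _ /=.
by case: (c _); rewrite ?addn0.
Qed.
End Transitions.

(** * Transitions compatible with the cycles, and the theorem *)

Lemma even_deg_cycle (V E : finType) (ends : E -> V * V) (C : {set E}) v :
  is_cycle ends C -> ~~ odd (deg_in ends C v).
Proof.
case=> _ [deg2 _]; case: (boolP (verts_of ends C v)) => [/deg2 -> //|].
rewrite /verts_of negb_exists => /forallP noC.
rewrite /deg_in (_ : [set e in C | _] = set0) ?cards0 //.
by apply/setP=> e; have := noC e; rewrite !inE => /negbTE.
Qed.

(** Half-edges are paired within classes given by their vertex and the cycle containing their edge,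
    if any. *)
Lemma family_pairing (V E : finType) (ends : E -> V * V) (t : nat) (O : {set {set E}}) :
  loopless ends -> regular ends (2 * t) ->
  (forall C, C \in O -> forall v, ~~ odd (deg_in ends C v)) ->
  (forall C D, C \in O -> D \in O -> C != D -> [disjoint C & D]) ->
  exists (s : E * bool -> E * bool) (H : {set E * bool}),
    [/\ involutive s, forall d, base ends (s d) = base ends d,
        forall d, (s d \in H) = (d \notin H) &
        forall C d, C \in O -> ((s d).1 \in C) = (d.1 \in C)].
Proof.
move=> Hloop Hreg evO dO.
pose lab e := [pick C in O | e \in C].
have labE C e : C \in O -> (lab e == Some C) = (e \in C).
  move=> CO; rewrite /lab; case: pickP => [D /andP[DO eD]|/(_ C)]; last by rewrite CO => /= ->.
  apply/eqP/idP => [[<-] //|eC]; congr Some; apply/eqP; apply: contraTT eD => DC.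
  by rewrite (disjointFl (dO _ _ DO CO DC)).
have [|s [H [sK sg sH]]] := @pairing _ _ (fun d => (base ends d, lab d.1)).
  case=> v k; pose n k' := #|[set d : E * bool | (base ends d, lab d.1) == (v, k')]|.
  rewrite -/(n k).
  have evS C : ~~ odd (n (Some C)).
    case: (boolP (C \in O)) => CO.
      rewrite (_ : n _ = deg_in ends C v) ?evO // card_darts //.
      by apply: eq_card => d; rewrite !inE xpair_eqE labE // andbC.
    rewrite /n (_ : [set d | _] = set0) ?cards0 //.
    apply/setP=> d; rewrite !inE xpair_eqE; apply/negbTE; apply: contra CO => /andP[_].
    by rewrite /lab; case: pickP => // D /andP[DO _] /eqP[<-].
  (* The unlabelled class at [v] is what the even classes of the cycles leave of [2 * t]
     half-edges. *)
  case: k => [C|]; first exact: evS.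
  have : \sum_k n k = 2 * t.
    rewrite -(Hreg v) card_darts // -[RHS]sum1_card.
    rewrite (partition_big (fun d : E * bool => lab d.1) xpredT) //=.
    apply: eq_bigr => k _; rewrite /n -sum1_card; apply: eq_bigl => d.
    by rewrite !inE xpair_eqE.
  rewrite (bigD1 None) //= => sumn; have : ~~ odd (2 * t) by rewrite oddM.
  rewrite -sumn oddD; apply: contra => ->; rewrite addTb.
  apply: (big_ind (fun m => ~~ odd m)) => // [a b|[C _|//]]; last exact: evS.
  by rewrite oddD => /negbTE-> /negbTE->.
exists s, H; split=> // [d|C d CO]; first by case: (sg d).
by case: (sg d) => _ labs; rewrite -!labE // labs.
Qed.

Theorem theorem5 (V E : finType) (ends : E -> V * V) (t : nat)
  (Ht2 : 2 <= t) (Htev : ~~ odd t)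
  (Hloop : loopless ends) (Hreg : regular ends (2 * t))
  (H2c : two_connected ends)
  (O : {set {set E}})
  (HOcyc : forall C, C \in O -> is_odd_cycle ends C)
  (HOdisj : forall C D, C \in O -> D \in O -> C != D -> [disjoint C & D]) :
  exists F : {set E}, is_factor ends t F /\
    forall C, C \in O -> (C :&: F != set0) /\ (C :&: ~: F != set0).
Proof.
have evO C : C \in O -> forall v, ~~ odd (deg_in ends C v).
  by move=> /HOcyc[cC _] v; apply: even_deg_cycle.
have [s [H [sK s_base sH sO]]] := family_pairing Hloop Hreg evO HOdisj.
pose xl := trail s \o @fst_edge _ H.
pose Q := [set x | odd #|[set z | xl z == x]|].
have [|||J0 [M [HM evJ HQ]]] := @incidence_selection _ _ _ xl (@pivot _ _ ends H) Q.
- by move=> v; rewrite (card_pivot (t := t) Hloop Hreg sK s_base sH).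
- by move=> x; rewrite inE; apply: (odd_trail_card Hloop sK s_base sH).
- exact: (transition_bridgeless (t := t) Ht2 Hloop Hreg H2c sK s_base sH).
have [||||J sJ [MJ [c [cN cJ]]]] :=
  @colouring _ _ _ (@fst_edge _ H) (@snd_edge _ s H) (trail s) J0 M.
- by move=> z; apply: trail_s.
- by move=> z /HM[].
- exact: evJ.
- exact: (transitions_connected sK sH).
exists [set e | c e]; split.
  apply: (balanced_factor (M := M) (J := J) Hloop Hreg sK s_base sH) => //.
  by move=> z zJ; have [_ ? _ ?] := HM z (subsetP sJ z zJ); rewrite MJ.
move=> C CO; have [_ oddC] := HOcyc C CO.
have linkC e f : trail s e = trail s f -> (e \in C) = (f \in C).
  move/eqP; rewrite root_connect; last exact: linked_connect_sym.
  move/closed_connect; apply => x y /existsP[b /eqP <-].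
  by rewrite sO.
(* [C] is a union of trails and has an odd number of edges, so one of these trails is odd. *)
have [e0 e0C oddx] : exists2 e, e \in C & trail s e \in Q.
  apply/exists_inP; apply: contraTT oddC; rewrite negb_exists => /forallP noodd.
  rewrite -sum1_card (partition_big (trail s) xpredT) //=.
  apply: (big_ind (fun m => ~~ odd m)) => // [m n|x _].
    by rewrite oddD => /negbTE-> /negbTE->.
  have [e /andP[eC /eqP ex]|none] := pickP [pred e in C | trail s e == x];
    last by rewrite big_pred0.
  have := noodd e; rewrite eC ex inE (card_trail sK sH) -sum1_card.
  congr (~~ odd _); apply: eq_bigl => f; rewrite inE andbC.
  by case: eqP => //= fx; rewrite (linkC f e) ?eC // fx ex.
(* The colour changes at a transition outside [J], and both of its edges lie in [C]. *)
have [z zx zJ] := HQ _ oddx; have {}zJ : z \notin J by apply: contraNN zJ => /(subsetP sJ).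
have pC : fst_edge z \in C by rewrite (linkC _ e0) // -zx.
have qC : snd_edge s z \in C by rewrite sO.
have := cN z zJ; 
case cp : (c _) ; case cq : (c _) => // _; split; apply/set0Pn;
  by [exists (fst_edge z); rewrite !inE pC ?cp | exists (snd_edge s z); rewrite !inE qC ?cq].
Qed.
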